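(* Let $(A,\Vert\cdot\Vert)$ be a uniform normed Q-algebra. Then $\Vert\cdot\Vert$ is the unique uniform Q-algebra norm on $A$; that is, if $\vert\cdot\vert$ is a uniform norm on $A$ such that $(A,\vert\cdot\vert)$ is a normed Q-algebra, then $\vert x\vert=\Vert x\Vert$ for all $x\in A$.
   Context: All algebras are associative algebras over the complex field $\mathbb{C}$, not assumed unital, commutative or complete unless stated. A normed algebra is an algebra $A$ with a submultiplicative norm. A uniform seminorm on an algebra $A$ is a seminorm $p$ on $A$ satisfying $p(x^{2})=p(x)^{2}$ for all $x\in A$ (by a known theorem of Dedania such a seminorm is automatically submultiplicative); a uniform norm is a uniform seminorm which is a norm. A uniform normed algebra is a normed algebra $(A,\Vert\cdot\Vert)$ with $\Vert x^{2}\Vert=\Vert x\Vert^{2}$ for all $x\in A$. An element $x$ is quasi-invertible if there is $y\in A$ with $x+y-xy=x+y-yx=0$. A topological algebra is a Q-algebra if its set of quasi-invertible elements is open; a normed Q-algebra is a normed algebra that is a Q-algebra for its norm topology, and a uniform normed Q-algebra is a uniform normed algebra that is a Q-algebra for its norm topology. A norm $\vert\cdot\vert$ on $A$ is a Q-algebra norm if $(A,\vert\cdot\vert)$ is a normed Q-algebra; a uniform Q-algebra norm is a Q-algebra norm that is also a uniform norm. *)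

(* Defs.v *)
From HB Require Import structures.
From mathcomp Require Import all_boot all_order all_algebra.
From mathcomp Require Import classical_sets reals.
From mathcomp Require Import complex.

Set Implicit Arguments.
Unset Strict Implicit.
Unset Printing Implicit Defensive.

Import Order.TTheory GRing.Theory Num.Theory.
Local Open Scope classical_set_scope.
Local Open Scope ring_scope.

(* MathComp's algebras ([algType] etc.) are all unital, so the associative,
   not necessarily unital, algebras over a commutative ring K are introduced
   as K-modules with an associative bilinear product. *)
HB.mixin Record Lmodule_isNonUnitalAlgebra (K : comNzRingType) A
    of GRing.Lmodule K A := {
  numul : A -> A -> A;
  numulA : associative numul;
  numulDl : left_distributive numul +%R;
  numulDr : right_distributive numul +%R;
  numulZl : forall (k : K) (x y : A), numul (k *: x) y = k *: numul x y;
  numulZr : forall (k : K) (x y : A), numul x (k *: y) = k *: numul x y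
}.

#[short(type="nuAlgType")]
HB.structure Definition NonUnitalAlgebra (K : comNzRingType) :=
  { A of Lmodule_isNonUnitalAlgebra K A & GRing.Lmodule K A }.

Notation "x ** y" := (numul x y) (at level 40, left associativity) : ring_scope.

Section QuasiInvertible.
Variables (K : comNzRingType) (A : nuAlgType K).

Definition quasi_invertible : set A :=
  [set x | exists y, x + y - x ** y = 0 /\ x + y - y ** x = 0].

End QuasiInvertible.

(* Two norms on the same algebra have to be compared, so seminorms are plain
   functions A -> R and the properties below are predicates on them, instead of
   a canonical norm and topology carried by the type A.  [normc a : R] is the
   modulus of a, whereas `|a| lives in R[i]. *)
Section Norms.
Variables (R : realType) (A : nuAlgType R[i]).
Implicit Type p : A -> R.

Definition is_seminorm p : Prop :=
  [/\ forall x, 0 <= p x,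
      forall x y, p (x + y) <= p x + p y &
      forall (a : R[i]) x, p (a *: x) = ComplexField.Normc.normc a * p x].

Definition is_norm p : Prop := is_seminorm p /\ forall x, p x = 0 -> x = 0.

Definition submultiplicative p : Prop := forall x y, p (x ** y) <= p x * p y.

Definition square_preserving p : Prop := forall x, p (x ** x) = p x ^+ 2.

Definition is_uniform_seminorm p : Prop := is_seminorm p /\ square_preserving p.

Definition is_uniform_norm p : Prop := is_uniform_seminorm p /\ is_norm p.

Definition is_normed_algebra p : Prop := is_norm p /\ submultiplicative p.

Definition is_uniform_normed_algebra p : Prop :=
  is_normed_algebra p /\ square_preserving p.

Definition norm_open p (U : set A) : Prop :=
  forall x, U x -> exists2 e : R, 0 < e & forall y, p (y - x) < e -> U y.

Definition is_Q_algebra p : Prop := norm_open p (@quasi_invertible _ A).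

Definition is_normed_Q_algebra p : Prop := is_normed_algebra p /\ is_Q_algebra p.

Definition is_uniform_normed_Q_algebra p : Prop :=
  is_uniform_normed_algebra p /\ is_Q_algebra p.

Definition is_uniform_Q_algebra_norm p : Prop :=
  is_normed_Q_algebra p /\ is_uniform_norm p.

End Norms.

(* Main.v *)
Require Import Defs.
From mathcomp Require Import all_boot all_order all_algebra.
From mathcomp Require Import classical_sets reals.
From mathcomp Require Import complex.
From mathcomp Require Import boolp topology normedtype sequences lra.

Set Implicit Arguments.
Unset Strict Implicit.
Unset Printing Implicit Defensive.

Import Order.TTheory GRing.Theory Num.Theory.
Import numFieldNormedType.Exports ComplexField.Normc.
Local Open Scope classical_set_scope.
Local Open Scope ring_scope.

(** Both norms are controlled by the same algebraic data: for a uniform norm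
    [p] with the Q-property, [p x < 1] holds exactly when [l *: x] is
    quasi-invertible for all complex [l] of modulus at most 1, so [p] is the
    spectral radius.

    The Q-property gives one direction ([Q_algebra_quasi_invertible]): if
    [p x < 1], the iterated squares of [x] tend to 0, so one of them is
    quasi-invertible, and quasi-invertibility of a square passes to its root
    because [1 - x^2 = (1 - x)(1 + x)].

    The converse ([seminorm_lt1_of_disc]) holds for every submultiplicative
    seminorm with the square property.  It is the hard half of the spectral
    radius formula, and Rickart's elementary argument proves it without
    completeness or complex analysis.  Write [q a] for the quasi-inverse of
    [a], and scale so that [p x = 1].
    Compactness of the disc and the resolvent identity bound
    [q (l *: x)] on the disc, so for [s < 1] close to 1 the elements
    [q (l *: x)] and [q (l *: s *: x)] differ by at most a small [e], for all
    [l] on the unit circle ([near_resolvents_shrink]).  Since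
    [q (a^2) = (q a + q (- a)) / 2], this estimate survives squaring [x] and
    [s *: x] simultaneously, with the same [e] ([near_resolvents_square]).
    After many squarings the powers of [s *: x] tend to 0, hence so do their
    quasi-inverses; therefore the quasi-inverse of a power [z] of [x] with
    [p z = 1] is small, which is absurd.

    Combining the two directions, a Q-norm that is uniform dominates every
    submultiplicative seminorm with the square property
    ([Q_algebra_dominates]); two uniform Q-norms dominate each other. *)

(** * Quasi-inverses *)

Section QuasiInverses.
Variables (K : comNzRingType) (A : nuAlgType K).
Implicit Types a b u v w x y : A.

Definition quasi_inverse x y := x ** y = x + y /\ y ** x = x + y.

Definition nusquare x := x ** x.

Lemma numulNl x y : (- x) ** y = - (x ** y).
Proof. by rewrite -scaleN1r numulZl scaleN1r. Qed.

Lemma numulNr x y : x ** (- y) = - (x ** y).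
Proof. by rewrite -scaleN1r numulZr scaleN1r. Qed.

Lemma numulBl x y z : (x - y) ** z = x ** z - y ** z.
Proof. by rewrite numulDl numulNl. Qed.

Lemma numulBr x y z : x ** (y - z) = x ** y - x ** z.
Proof. by rewrite numulDr numulNr. Qed.

Lemma nusquareZ k x : nusquare (k *: x) = k ^+ 2 *: nusquare x.
Proof. by rewrite /nusquare numulZl numulZr scalerA expr2. Qed.

Lemma quasi_invertibleP x :
  quasi_invertible x <-> exists y, quasi_inverse x y.
Proof.
split=> -[y [xy yx]]; exists y; split; first exact/esym/subr0_eq.
- exact/esym/subr0_eq.
- by rewrite xy subrr.
- by rewrite yx subrr.
Qed.

Lemma quasi_inverse0 : quasi_inverse 0 0.
Proof. by rewrite /quasi_inverse -[X in X ** _](scale0r 0) numulZl scale0r addr0. Qed.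

(** Bounds a quasi-invertible element by its quasi-inverse, whereas
    [quasi_inverse_eqr] bounds the quasi-inverse by the element. *)
Lemma quasi_inverse_eqNr x y : quasi_inverse x y -> x = x ** y - y.
Proof. by case=> -> _; rewrite addrK. Qed.

Lemma quasi_inverse_eqr x y : quasi_inverse x y -> y = x ** y - x.
Proof. by case=> -> _; rewrite addrC addKr. Qed.

(** Formally [1 - u] is a left inverse and [1 - v] a right inverse of [1 - x],
    so both equal [(1 - u)(1 - x)(1 - v)]. *)
Lemma left_right_quasi_inverse_eq x u v :
  u ** x = u + x -> x ** v = x + v -> u = v.
Proof.
move=> ux xv; have := numulA u x v; rewrite ux xv numulDr numulDl ux xv.
by rewrite addrC => /addrI; rewrite addrC => /addrI.
Qed.

Lemma left_right_quasi_invertible x u v :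
  u ** x = u + x -> x ** v = x + v -> quasi_invertible x.
Proof.
move=> ux xv; apply/quasi_invertibleP; exists u; split; last by rewrite addrC.
by rewrite (left_right_quasi_inverse_eq ux xv).
Qed.

Lemma quasi_inverse_unique x u v :
  quasi_inverse x u -> quasi_inverse x v -> u = v.
Proof.
by move=> [_ ux] [xv _]; apply: left_right_quasi_inverse_eq xv; rewrite addrC.
Qed.

(** From [1 - x^2 = (1 - x)(1 + x) = (1 + x)(1 - x)], the inverse [1 - w] of
    [1 - x^2] gives the left inverse [(1 - w)(1 + x)] and the right inverse
    [(1 + x)(1 - w)] of [1 - x]. *)
Lemma quasi_inverse_square x w :
  quasi_inverse (nusquare x) w -> quasi_invertible x.
Proof.
rewrite /nusquare => -[xw wx].
apply: (@left_right_quasi_invertible _ (w - x + w ** x) (w - x + x ** w)).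
- rewrite numulDl numulBl -numulA wx addrA subrK.
  by rewrite addrAC subrK addrC.
- rewrite numulDr numulBr numulA xw addrA subrK.
  by rewrite [RHS]addrC addrAC subrK addrC.
Qed.

(** This is [(1 - u) - (1 - v) = (1 - u)((1 - b) - (1 - a))(1 - v)], expanded
    so that the unit disappears; here [1 - u] and [1 - v] are the inverses of
    [1 - a] and [1 - b]. *)
Lemma resolvent_identity a b u v :
  quasi_inverse a u -> quasi_inverse b v ->
  v - u = (a - b) - u ** (a - b) - ((a - b) - u ** (a - b)) ** v.
Proof.
move=> [_ ua] [bv _].
have -> : (a - b) - u ** (a - b) = u ** b - (u + b).
  rewrite numulBr ua addrC opprD opprK -addrA addrCA; congr (_ + _).
  by rewrite opprD [- a - u]addrC -addrA addKr opprD.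
rewrite numulBl -numulA bv numulDr numulDl bv.
rewrite [u ** b + u ** v - _]addrKA opprB [RHS]addrC addrA subrK.
by rewrite [u + b]addrC opprD addrACA subrr add0r.
Qed.

(** The average over the two square roots of unity:
    [(1 - x^2)^-1 = ((1 - x)^-1 + (1 + x)^-1) / 2].  The scalar [h] stands for
    one half. *)
Lemma quasi_inverse_nusquare (h : K) x u v : h + h = 1 ->
  quasi_inverse x u -> quasi_inverse (- x) v ->
  quasi_inverse (nusquare x) (h *: (u + v)).
Proof.
move=> h2 [xu ux] [xv vx].
have xv' : x ** v = x - v by rewrite -[LHS]opprK -numulNl xv opprD opprK.
have vx' : v ** x = x - v by rewrite -[LHS]opprK -numulNr vx opprD opprK.
have hK y : y = h *: (y + y) by rewrite scalerDr -scalerDl h2 scale1r.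
split; rewrite /nusquare (numulZl, numulZr) {2}[x ** x]hK -scalerDr;
  congr (_ *: _).
- rewrite -numulA numulDr xu xv' !numulDr numulNr xu xv' addrACA opprB.
  by rewrite [x + u]addrC [u + x + _]addrACA subrr addr0.
- rewrite numulA numulDl ux vx' !numulDl numulNl ux vx' addrACA opprB.
  by rewrite [x + u]addrC [u + x + _]addrACA subrr addr0.
Qed.

End QuasiInverses.

(** * The closed unit disc *)

Section ClosedDisc.
Variable R : realType.
Implicit Types z w : R[i].

Lemma normc_ge0 z : 0 <= normc z.
Proof. by case: z => a b; exact: sqrtr_ge0. Qed.

Lemma normc_real (r : R) : normc r%:C%C = `|r|.
Proof. by rewrite /normc /= expr0n addr0 sqrtr_sqr. Qed.

Lemma normcX z n : normc (z ^+ n) = normc z ^+ n.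
Proof.
elim: n => [|n IHn]; first exact: normc1.
by rewrite !exprS normcM IHn.
Qed.

Lemma normcN1 : normc (- 1 : R[i]) = 1.
Proof. by rewrite -[1]/(1%:C%C) -rmorphN normc_real normrN normr1. Qed.

Lemma normcN z : normc (- z) = normc z.
Proof. by rewrite -mulN1r normcM normcN1 mul1r. Qed.

Lemma normc_sqrtC z : normc z = 1 -> normc (sqrtC z) = 1.
Proof.
move=> z1; have : normc (sqrtC z) ^+ 2 = 1 by rewrite -normcX sqrtCK.
by move/eqP; rewrite sqrp_eq1 ?normc_ge0 // => /eqP.
Qed.

Lemma normc_le1 (a b : R) : (normc (a +i* b)%C <= 1) = (a ^+ 2 + b ^+ 2 <= 1).
Proof. by rewrite /normc -[X in _ <= X]sqrtr1 ler_sqrt. Qed.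

Lemma normc_le_add (a b : R) : normc (a +i* b)%C <= `|a| + `|b|.
Proof.
rewrite -[leRHS]ger0_norm ?addr_ge0 // -sqrtr_sqr ler_wsqrtr //.
by rewrite sqrrD !real_normK ?num_real // lerD2r lerDl mulrn_wge0 ?mulr_ge0.
Qed.

(** Complex numbers are replaced by pairs of reals, so that the disc is a closed
    subset of a product of two compact segments. *)
Lemma closed_disc_compact : compact [set ab : R * R | ab.1 ^+ 2 + ab.2 ^+ 2 <= 1].
Proof.
apply: (@subclosed_compact _ _ (`[(- 1 : R), 1]%classic `*` `[(- 1 : R), 1]%classic)).
- apply: (@preimage_closed _ _ (fun ab : R * R => ab.1 ^+ 2 + ab.2 ^+ 2)
            [set r | r <= 1]); last exact: closed_le.
  move=> ab _; apply: cvgD.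
    by apply: cvgM; exact: cvg_fst.
  by apply: cvgM; exact: cvg_snd.
- by apply: compact_setX; exact: segment_compact.
- move=> [a b] /= ab1; have a2 := sqr_ge0 a; have b2 := sqr_ge0 b.
  by split; rewrite /= in_itv /=; apply/andP; split; nra.
Qed.

(** By compactness, a bound near each point of the disc, itself varying with the
    point, gives a single bound. *)
Lemma closed_disc_bounded (f : R[i] -> R) :
  (forall z, normc z <= 1 -> exists e M, 0 < e /\
     forall w, normc w <= 1 -> normc (w - z) < e -> f w <= M) ->
  exists M, forall z, normc z <= 1 -> f z <= M.
Proof.
move=> floc.
have /compact_near_coveringP disc := closed_disc_compact.
(* Near-covering along the filter at +oo: a bound valid near each point
   becomes a bound valid on the whole disc. *)
have [] := disc R (pinfty_nbhs R) (fun M ab => normc (ab.1 +i* ab.2)%C <= 1 ->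
  f (ab.1 +i* ab.2)%C <= M) _.
- move=> [a b] /=; rewrite -normc_le1 => ab1.
  have [e [M [e0 fM]]] := floc _ ab1.
  exists (ball (a, b) (e / 2), [set M' | M <= M']) => /=.
    split; first by apply: nbhsx_ballx; rewrite divr_gt0.
    exact: nbhs_pinfty_ge (num_real _).
  move=> [[c d] M'] /= [[/= ac bd] MM'] cd1.
  apply: le_trans MM'; apply: fM => //.
  apply: le_lt_trans (normc_le_add (c - a) (d - b)) _.
  by rewrite distrC [`|d - b|]distrC [ltRHS]splitr ltrD.
- move=> M [_ fM]; exists (M + 1) => -[a b] ab1.
  by apply: (fM (M + 1) _ (a, b)); rewrite ?ltrDl //= -normc_le1.
Qed.

End ClosedDisc.

(** * Resolvents in a submultiplicative seminorm *)

Lemma expr_pow2_lt (R : realType) (s e : R) :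
  0 <= s -> s < 1 -> 0 < e -> exists k, s ^+ (2 ^ k) < e.
Proof.
move=> s0 s1 e0; have /cvgr_lt/(_ e e0) : s ^+ n @[n --> \oo] --> (0 : R).
  by apply: cvg_expr; rewrite ger0_norm.
by case=> k _ sk; exists k; apply: sk; exact/ltnW/ltn_expl.
Qed.

Section Seminorm.
Variables (R : realType) (A : nuAlgType R[i]) (p : A -> R).
Hypothesis p_sn : is_seminorm p.
Implicit Types x y u v : A.

Lemma seminorm_ge0 x : 0 <= p x.
Proof. by case: p_sn. Qed.

Lemma seminormD x y : p (x + y) <= p x + p y.
Proof. by case: p_sn. Qed.

Lemma seminormZ (a : R[i]) x : p (a *: x) = normc a * p x.
Proof. by case: p_sn. Qed.

Lemma seminormN x : p (- x) = p x.
Proof. by rewrite -scaleN1r seminormZ normcN1 mul1r. Qed.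

Lemma seminormB x y : p (x - y) <= p x + p y.
Proof. by rewrite -(seminormN y) seminormD. Qed.

Lemma seminorm_distC x y : p (x - y) = p (y - x).
Proof. by rewrite -opprB seminormN. Qed.

Hypothesis pM : submultiplicative p.

Lemma seminorm_resolvent a b u v :
  quasi_inverse a u -> quasi_inverse b v ->
  p (v - u) <= (1 + p u) * p (a - b) * (1 + p v).
Proof.
move=> au bv; rewrite (resolvent_identity au bv).
set d := a - b; have d0 := seminorm_ge0 d.
have u0 := seminorm_ge0 u; have v0 := seminorm_ge0 v.
have dud : p (d - u ** d) <= (1 + p u) * p d.
  by apply: le_trans (seminormB _ _) _; rewrite mulrDl mul1r lerD2l pM.
apply: le_trans (seminormB _ _) _.
apply: le_trans (lerD dud (le_trans (pM _ _) (ler_wpM2r v0 dud))) _.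
by rewrite [leRHS]mulrDr mulr1.
Qed.

Lemma quasi_inverse_small x u : quasi_inverse x u -> p u <= p x * (1 + p u).
Proof.
move=> xu; rewrite {1}(quasi_inverse_eqr xu).
by apply: le_trans (seminormB _ _) _; rewrite mulrDr mulr1 addrC lerD2l pM.
Qed.

(** By the resolvent identity the quasi-inverse of [m *: x] is bounded for [m]
    near any fixed [l] of the disc; compactness makes the bound uniform. *)
Lemma resolvent_bounded x :
  (forall l : R[i], normc l <= 1 -> quasi_invertible (l *: x)) ->
  exists M, forall l u, normc l <= 1 -> quasi_inverse (l *: x) u -> p u <= M.
Proof.
move=> inv_x.
have : forall l : R[i], exists u, normc l <= 1 -> quasi_inverse (l *: x) u.
  move=> l; have [/inv_x/quasi_invertibleP[u xu]|] := boolP (normc l <= 1).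
    by exists u.
  by exists 0.
move=> /boolp.choice[q qP].
have [l l1|M qM] := @closed_disc_bounded _ (p \o q); last first.
  exists M => l u l1 xu.
  by rewrite (quasi_inverse_unique xu (qP l l1)); exact: qM.
have T0 := seminorm_ge0 (q l); have x0 := seminorm_ge0 x.
(* Within distance 1 / (2 (1 + c)) of l, the resolvent identity gives
   p (q m) <= T + (1 + p (q m)) / 2, hence p (q m) <= 2 T + 1. *)
set T := p (q l) in T0; set c := (1 + T) * p x.
have c0 : 0 <= c by rewrite mulr_ge0 ?addr_ge0.
exists ((2 * (1 + c))^-1), (2 * T + 1); split; first by rewrite invr_gt0; lra.
move=> m m1 ml /=.
have m0 := seminorm_ge0 (q m).
have := seminorm_resolvent (qP l l1) (qP m m1).
have := seminormD (q m - q l) (q l); rewrite subrK -/T.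
rewrite -scalerBl seminormZ -[l - m]opprB normcN.
rewrite mulrCA -/c.
have : normc (m - l) * c <= 2^-1.
  have d0 : 0 < 2 * (1 + c) by lra.
  apply: le_trans (ler_wpM2r c0 (ltW ml)) _.
  rewrite mulrC ler_pdivrMr //; lra.
have := seminorm_ge0 (q m - q l).
nra.
Qed.

Definition near_resolvents e x y := forall l : R[i], normc l = 1 ->
  exists u v, [/\ quasi_inverse (l *: x) u, quasi_inverse (l *: y) v &
                  p (u - v) <= e].

(** A number [l] on the unit circle has a square root [m] on it, and the
    quasi-inverses at [m *: x] and [- m *: x] average to the one at
    [l *: nusquare x].  The error [e] is averaged too, hence does not grow. *)
Lemma near_resolvents_square e x y :
  near_resolvents e x y -> near_resolvents e (nusquare x) (nusquare y).
Proof.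
move=> xy l l1; set m := sqrtC l.
have m1 : normc m = 1 by apply: normc_sqrtC.
have Nm1 : normc (- m) = 1 by rewrite normcN.
have [u [v [xu yv uv]]] := xy m m1; have [u' [v' [xu' yv' uv']]] := xy (- m) Nm1.
rewrite !scaleNr in xu' yv'.
have h2 : 2^-1 + 2^-1 = 1 :> R[i] by rewrite [RHS]splitr mul1r.
exists (2^-1 *: (u + u')), (2^-1 *: (v + v')); split.
- rewrite -[l]sqrtCK -nusquareZ; exact: quasi_inverse_nusquare.
- rewrite -[l]sqrtCK -nusquareZ; exact: quasi_inverse_nusquare.
- rewrite -scalerBr opprD addrACA seminormZ.
  have -> : normc (2^-1 : R[i]) = 2^-1.
    by rewrite normcV -(rmorph_nat (real_complex R)) normc_real normr_nat.
  have := seminormD (u - v) (u' - v'); lra.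
Qed.

(** The resolvent identity with uniformly bounded resolvents makes
    [l |-> quasi-inverse of l *: x] uniformly continuous on the disc. *)
Lemma near_resolvents_shrink e x : 0 < e ->
  (forall l : R[i], normc l <= 1 -> quasi_invertible (l *: x)) ->
  exists s : R, [/\ 0 <= s, s < 1 & near_resolvents e x (s%:C%C *: x)].
Proof.
move=> e0 inv_x; have [M xM] := resolvent_bounded inv_x.
set K := (1 + M) ^+ 2 * p x.
have K0 : 0 <= K by rewrite mulr_ge0 ?sqr_ge0 ?seminorm_ge0.
have Ke0 : 0 < K + e by lra.
(* 1 - s is chosen at most e / K, the denominator K + e keeping it in ]0, 1]. *)
pose t := e / (K + e).
have t0 : 0 < t by rewrite divr_gt0.
have t1 : t <= 1 by rewrite ler_pdivrMr // mul1r; lra.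
have tK : t * K <= e.
  by rewrite mulrAC ler_pdivrMr // ler_pM2l //; lra.
exists (1 - t); split; [lra|lra|move=> l l1].
have l1' : normc l <= 1 by rewrite l1.
have ls1 : normc (l * (1 - t)%:C%C) <= 1.
  by rewrite normcM l1 mul1r normc_real ger0_norm; lra.
have /quasi_invertibleP[u xu] := inv_x _ l1'.
have /quasi_invertibleP[v yv] := inv_x _ ls1.
exists u, v; rewrite scalerA; split=> //; rewrite seminorm_distC.
apply: le_trans (seminorm_resolvent xu yv) _.
have -> : p (l *: x - (l * (1 - t)%:C%C) *: x) = t * p x.
  rewrite -scalerBl -[X in X - _]mulr1 -mulrBr -(rmorphB (real_complex R) 1).
  by rewrite seminormZ normcM l1 mul1r normc_real opprB addrC subrK gtr0_norm.
have uM := xM _ _ l1' xu; have vM := xM _ _ ls1 yv.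
have u0 := seminorm_ge0 u; have v0 := seminorm_ge0 v.
apply: le_trans tK; rewrite mulrAC mulrC -mulrA ler_pM2l // mulrC.
rewrite ler_wpM2r ?seminorm_ge0 // expr2.
by apply: ler_pM; lra.
Qed.

Hypothesis p_sq : square_preserving p.

Lemma seminorm_iter_nusquare k x : p (iter k (@nusquare _ A) x) = p x ^+ (2 ^ k).
Proof.
elim: k => [|k IHk] //=.
by rewrite /nusquare p_sq IHk -exprM expnSr.
Qed.

(** The spectral radius bounds a uniform seminorm from above, by comparing the
    iterated squares of [x] with those of [s *: x] for some [s < 1]. *)
Lemma seminorm_lt1_of_disc x :
  (forall l : R[i], normc l <= 1 -> quasi_invertible (l *: x)) -> p x < 1.
Proof.
wlog px1 : x / p x = 1.
  move=> claim inv_x; rewrite ltNge; apply/negP => px1.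
  have px0 : 0 < p x by apply: lt_le_trans px1.
  have npV : normc (p x)^-1%:C%C = (p x)^-1 by rewrite normc_real ger0_norm ?invr_ge0 ?ltW.
  have px'1 : p ((p x)^-1%:C%C *: x) = 1 by rewrite seminormZ npV mulVf ?gt_eqF.
  suff: p ((p x)^-1%:C%C *: x) < 1 by rewrite px'1 ltxx.
  apply: claim => // l l1; rewrite scalerA; apply: inv_x.
  by rewrite normcM npV mulr_ile1 ?normc_ge0 ?invr_ge0 ?invf_le1 // ltW.
move=> inv_x; exfalso.
have e0 : 0 < 8^-1 :> R by lra.
have [s [s0 s1 near0]] := near_resolvents_shrink e0 inv_x.
pose y := s%:C%C *: x.
have py : p y = s by rewrite seminormZ normc_real ger0_norm // px1 mulr1.
have near_k k :
    near_resolvents 8^-1 (iter k (@nusquare _ A) x) (iter k (@nusquare _ A) y).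
  by elim: k => [//|k IHk]; exact: near_resolvents_square.
have [k sk] := expr_pow2_lt s0 s1 e0.
have := near_k k 1 (normc1 _); rewrite !scale1r.
move=> [u [v [xu yv uv]]].
(* p v <= (1/8) / (1 - 1/8) = 1/7 and p u <= 1/8 + 1/7, while the relation
   x = x ** u - u at an element of seminorm 1 forces 1 <= 2 * p u. *)
have := quasi_inverse_small yv; rewrite seminorm_iter_nusquare py => pv.
have := seminormD (u - v) v; rewrite subrK => pu.
have : p (iter k (@nusquare _ A) x) <= p (iter k (@nusquare _ A) x) * p u + p u.
  rewrite {1}(quasi_inverse_eqNr xu).
  by apply: le_trans (seminormB _ _) _; rewrite lerD2r pM.
rewrite seminorm_iter_nusquare px1 expr1n.
have := seminorm_ge0 v; nra.
Qed.

(** The open set of quasi-invertible elements contains 0, hence contains a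
    small enough iterated square of [x]; square roots are then taken back. *)
Lemma Q_algebra_quasi_invertible x : is_Q_algebra p -> p x < 1 ->
  quasi_invertible x.
Proof.
move=> pQ px1.
have inv0 : quasi_invertible (0 : A).
  by apply/quasi_invertibleP; exists 0; exact: quasi_inverse0.
have [e e0 inv_e] := pQ 0 inv0.
have [k xk] := expr_pow2_lt (seminorm_ge0 x) px1 e0.
have : quasi_invertible (iter k (@nusquare _ A) x).
  by apply: inv_e; rewrite subr0 seminorm_iter_nusquare.
elim: k {xk} => [//|k IHk] /quasi_invertibleP[w /quasi_inverse_square].
exact: IHk.
Qed.

End Seminorm.

(** * Comparison of uniform norms *)

(** If [N x < p x], then [c *: x] with [c := (p x)^-1] has [N]-norm less than 1,
    so the whole disc times it consists of quasi-invertible elements by the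
    Q-property of [N]; this forces [p (c *: x) < 1], although it equals 1. *)
Lemma Q_algebra_dominates (R : realType) (A : nuAlgType R[i]) (N p : A -> R) :
  is_uniform_normed_Q_algebra N -> is_seminorm p -> submultiplicative p ->
  square_preserving p -> forall x, p x <= N x.
Proof.
move=> [[[[N_sn _] NM] N_sq] NQ] p_sn pM p_sq x; rewrite leNgt; apply/negP => Nx.
have p0 : 0 < p x := le_lt_trans (seminorm_ge0 N_sn x) Nx.
pose c := (p x)^-1.
have nc : normc c%:C%C = c by rewrite normc_real gtr0_norm ?invr_gt0.
have : p (c%:C%C *: x) < 1.
  apply: seminorm_lt1_of_disc => // l l1.
  apply: (Q_algebra_quasi_invertible N_sn) => //.
  rewrite !(seminormZ N_sn) nc; apply: le_lt_trans (_ : c * N x < 1).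
    by rewrite ler_piMl // mulr_ge0 ?seminorm_ge0 ?invr_ge0 ?ltW.
  by rewrite mulrC ltr_pdivrMr ?mul1r.
by rewrite seminormZ // nc mulVf ?ltxx ?gt_eqF.
Qed.

Theorem corollary2p2 (R : realType) (A : nuAlgType R[i]) (N : A -> R) :
  is_uniform_normed_Q_algebra N ->
  is_uniform_Q_algebra_norm N /\
  forall N' : A -> R, is_uniform_Q_algebra_norm N' -> forall x : A, N' x = N x.
Proof.
move=> NuQ; have [[[N_norm NM] N_sq] NQ] := NuQ.
have N_sn : is_seminorm N by case: N_norm.
split=> [//|N' [[[N'_norm N'M] N'Q] [[N'_sn N'_sq] _]] x].
apply/eqP; rewrite eq_le; apply/andP; split; first exact: Q_algebra_dominates.
exact: Q_algebra_dominates.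
Qed.
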